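(* Let $F=\frac1n(f_1+\cdots+f_n):\mathcal{X}\to\mathbb{R}$ with $\mathcal{X}\subseteq\mathbb{R}^d$ and differentiable components $f_i$. Let $\boldsymbol{g}_1,\ldots,\boldsymbol{g}_n$ be unbiased component gradient estimators ($\mathbb{E}\,\boldsymbol{g}_i(\boldsymbol{x})=\nabla f_i(\boldsymbol{x})$) and $\boldsymbol{g}_B(\boldsymbol{x})=\frac1b\sum_{i\in B}\boldsymbol{g}_i(\boldsymbol{x})$, where $B\sim\pi$ is drawn independently of the estimators by an unbiased subsampling strategy of size $b$ with effective sample size $b_{\mathrm{eff}}$. Assume: 1. there is $\rho\in[0,1]$ such that for all $\boldsymbol{x}\in\mathcal{X}$ the $\boldsymbol{g}_i(\boldsymbol{x})$ have finite variance and, for all $i\ne j$, $\mathrm{tr}\,\mathrm{Cov}(\boldsymbol{g}_i(\boldsymbol{x}),\boldsymbol{g}_j(\boldsymbol{x}))\le\rho\sqrt{\mathrm{tr}\,\mathbb{V}[\boldsymbol{g}_i(\boldsymbol{x})]}\sqrt{\mathrm{tr}\,\mathbb{V}[\boldsymbol{g}_j(\boldsymbol{x})]}$; 2. there are finite constants $\tau^2$ and $\sigma_1^2,\ldots,\sigma_n^2$ ($\tau,\sigma_i\ge0$) such that for all $\boldsymbol{x}_*\in\arg\min_{\mathcal{X}}F$: $\frac1n\sum_{i=1}^n\|\nabla f_i(\boldsymbol{x}_* )\|_2^2\le\tau^2$ and $\mathrm{tr}\,\mathbb{V}[\boldsymbol{g}_i(\boldsymbol{x}_* )]\le\sigma_i^2$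 for $i=1,\ldots,n$. Then $\boldsymbol{g}_B$ satisfies $\mathrm{BV}(\sigma^2)$, i.e. $\mathrm{tr}\,\mathbb{V}[\boldsymbol{g}_B(\boldsymbol{x}_* )]\le\sigma^2$ for all $\boldsymbol{x}_*\in\arg\min_{\mathcal{X}}F$, where $$\sigma^2=\Big(\frac{\rho}{b_{\mathrm{eff}}}+\frac{1-\rho}{b}\Big)\Big(\frac1n\sum_{i=1}^n\sigma_i^2\Big)+\rho\Big(1-\frac1{b_{\mathrm{eff}}}\Big)\Big(\frac1n\sum_{i=1}^n\sigma_i\Big)^2+\frac{\tau^2}{b_{\mathrm{eff}}}.$$ Equality in the bound $\mathrm{tr}\,\mathbb{V}[\boldsymbol{g}_B(\boldsymbol{x}_* )]\le\sigma^2$ holds if equality holds in the correlation inequality of assumption 1.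
   Context: $\mathrm{tr}\,\mathbb{V}[\boldsymbol{x}]=\mathbb{E}\|\boldsymbol{x}-\mathbb{E}\boldsymbol{x}\|_2^2$ and $\mathrm{tr}\,\mathrm{Cov}(\boldsymbol{x},\boldsymbol{y})=\mathbb{E}\langle\boldsymbol{x}-\mathbb{E}\boldsymbol{x},\boldsymbol{y}-\mathbb{E}\boldsymbol{y}\rangle$. A subsampling strategy $\pi$ of size $b$ is a distribution on index sets $B\subseteq\{1,\ldots,n\}$ with $|B|=b$; it is unbiased if $\mathbb{E}[\frac1b\sum_{i\in B}\boldsymbol{v}_i]=\frac1n\sum_i\boldsymbol{v}_i$ for all vectors $\boldsymbol{v}_1,\dots,\boldsymbol{v}_n$, and has effective sample size $b_{\mathrm{eff}}$ if for all such vectors, with average $\bar{\boldsymbol{v}}$, $\mathrm{tr}\,\mathbb{V}[\frac1b\sum_{i\in B}\boldsymbol{v}_i]=\frac1{b_{\mathrm{eff}}}\frac1n\sum_i\|\boldsymbol{v}_i-\bar{\boldsymbol{v}}\|_2^2$ (with $1/\infty=0$).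
   Formalization: The equality claim is false as stated (σ_i, τ may be slack); equality is proved at a minimizer x_* with equality in the correlation inequality, tr V[g_i(x_* )]=σ_i², (1/n)Σ‖∇f_i(x_* )‖²=τ², and, if b_eff<∞, x_* interior to X or ∇F(x_* )=0. *)

(* Defs.v *)
From HB Require Import structures.
From mathcomp Require Import all_boot all_order all_algebra.
From mathcomp Require Import all_classical all_reals all_analysis.

Set Implicit Arguments.
Unset Strict Implicit.
Unset Printing Implicit Defensive.

Import Order.TTheory GRing.Theory Num.Theory.
Import numFieldNormedType.Exports.

Local Open Scope classical_set_scope.
Local Open Scope ring_scope.

Definition dotv (R : realType) (d : nat) (u v : 'rV[R]_d) : R :=
  \sum_(k < d) u 0 k * v 0 k.

(* The library norm `|v| on 'rV[R]_d is the sup norm, hence this definition. *)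
Definition l2norm (R : realType) (d : nat) (v : 'rV[R]_d) : R :=
  Num.sqrt (dotv v v).

(* Meaningful where f is differentiable. *)
Definition gradient (R : realType) (d : nat) (f : 'rV[R]_d -> R)
    (x : 'rV[R]_d) : 'rV[R]_d :=
  \row_(k < d) 'D_(delta_mx 0 k) f x.

Definition argmin (R : realType) (T : Type) (D : set T) (F : T -> R) : set T :=
  [set x | D x /\ forall y, D y -> F x <= F y].

Definition average (R : realType) (V : lmodType R) (n : nat) (v : 'I_n -> V) : V :=
  n%:R^-1 *: \sum_(i < n) v i.

Definition avgR (R : realType) (n : nat) (a : 'I_n -> R) : R :=
  n%:R^-1 * \sum_(i < n) a i.

Definition batch_average (R : realType) (V : lmodType R) (n b : nat)
    (v : 'I_n -> V) (B : {set 'I_n}) : V :=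
  b%:R^-1 *: \sum_(i in B) v i.

Section random_vectors.
Context (disp : measure_display) (Omega : measurableType disp) (R : realType).
Context (P : probability Omega R) (d : nat).
Implicit Types Y Z : Omega -> 'rV[R]_d.

(* Each coordinate is measurable and has a finite expectation. *)
Definition integrable_vec Y : Prop :=
  forall k : 'I_d, P.-integrable setT (EFin \o (fun w => Y w 0 k)).

(* Meaningful for integrable Y: [fine] sends infinite values to 0. *)
Definition mean Y : 'rV[R]_d :=
  \row_(k < d) fine 'E_P[fun w => Y w 0 k].

Definition trVar Y : \bar R :=
  'E_P[fun w => l2norm (Y w - mean Y) ^+ 2].

Definition trCov Y Z : \bar R :=
  'E_P[fun w => dotv (Y w - mean Y) (Z w - mean Z)].

Definition finite_variance Y : Prop :=
  integrable_vec Y /\ (trVar Y < +oo)%E.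

(* Independence of B from the sigma-algebra generated by the whole family
   (Y i); since B has finitely many values, the events {B = S} suffice. *)
Definition indep_set_family (n : nat) (B : Omega -> {set 'I_n})
    (Y : 'I_n -> Omega -> 'rV[R]_d) : Prop :=
  forall (S : {set 'I_n}) (E : set Omega),
    <<s [set C | exists (i : 'I_n) (k : 'I_d) (A : set R),
           measurable A /\ C = (fun w => Y i w 0 k) @^-1` A] >> E ->
    P (B @^-1` [set S] `&` E) = (P (B @^-1` [set S]) * P E)%E.

Definition BV (D : set 'rV[R]_d) (F : 'rV[R]_d -> R)
    (g : 'rV[R]_d -> Omega -> 'rV[R]_d) (s2 : R) : Prop :=
  forall x, argmin D F x -> (trVar (g x) <= s2%:E)%E.

End random_vectors.

(* A law on index sets, given by its probability mass function. *)
Definition subsampling (R : realType) (n b : nat)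
    (pi : {set 'I_n} -> R) : Prop :=
  [/\ forall B, 0 <= pi B,
      \sum_(B : {set 'I_n}) pi B = 1 &
      forall B, pi B != 0 -> #|B| = b].

Definition has_law (disp : measure_display) (Omega : measurableType disp)
    (R : realType) (P : probability Omega R) (n : nat)
    (B : Omega -> {set 'I_n}) (pi : {set 'I_n} -> R) : Prop :=
  forall S, measurable (B @^-1` [set S]) /\ P (B @^-1` [set S]) = (pi S)%:E.

Definition batch_mean (R : realType) (d n b : nat) (pi : {set 'I_n} -> R)
    (v : 'I_n -> 'rV[R]_d) : 'rV[R]_d :=
  \sum_(B : {set 'I_n}) pi B *: batch_average b v B.

Definition batch_trVar (R : realType) (d n b : nat) (pi : {set 'I_n} -> R)
    (v : 'I_n -> 'rV[R]_d) : R :=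
  \sum_(B : {set 'I_n})
    pi B * l2norm (batch_average b v B - batch_mean b pi v) ^+ 2.

Definition unbiased_subsampling (R : realType) (d n b : nat)
    (pi : {set 'I_n} -> R) : Prop :=
  forall v : 'I_n -> 'rV[R]_d, batch_mean b pi v = average v.

(* The library inverse on \bar R satisfies +oo^-1 = 0, so for 0 < beff this is
   the real number 1 / beff with the convention 1 / oo = 0. *)
Definition inv_size (R : realType) (beff : \bar R) : R := fine (beff^-1)%E.

Definition effective_size (R : realType) (d n b : nat)
    (pi : {set 'I_n} -> R) (beff : \bar R) : Prop :=
  (0 < beff)%E /\
  forall v : 'I_n -> 'rV[R]_d,
    batch_trVar b pi v =
    inv_size beff * avgR (fun i => l2norm (v i - average v) ^+ 2).

Definition BV_constant (R : realType) (n b : nat) (beff : \bar R)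
    (rho tau : R) (sigma : 'I_n -> R) : R :=
  (rho * inv_size beff + (1 - rho) / b%:R) * avgR (fun i => sigma i ^+ 2)
  + rho * (1 - inv_size beff) * avgR sigma ^+ 2
  + tau ^+ 2 * inv_size beff.

(* Main.v *)
Require Import Defs.
From HB Require Import structures.
From mathcomp Require Import all_boot all_order all_algebra.
From mathcomp Require Import all_classical all_reals all_analysis.
From mathcomp Require Import measurable_realfun ring lra.

Import Order.TTheory GRing.Theory Num.Theory.
Import numFieldNormedType.Exports.

Local Open Scope classical_set_scope.
Local Open Scope ring_scope.

(* Write C i j for the cross-covariance traces at x, m i for the means and c
   for 1 / b_eff.  Conditioning on the independent batch gives
     tr V[g_B] = E_B[b^-2 \sum_(i, j in B) C i j] + tr V[b^-1 \sum_(i in B) m i],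
   and the second term is c (avg |m i|^2 - |avg m|^2) by the definition of
   b_eff.  In the first term, C i i <= sigma i ^ 2 and
   C i j <= rho sigma i sigma j for i != j; the resulting bound is
     rho E_B[(b^-1 \sum_(i in B) sigma i)^2]
       + (1 - rho) / b E_B[b^-1 \sum_(i in B) sigma i ^ 2],
   evaluated by applying unbiasedness and the effective sample size to vectors
   on a line.  In the equality case either c = 0, or avg m = grad F vanishes, at an
   interior minimizer by Fermat's rule. *)

(** * Bilinearity of the Euclidean inner product *)

Section dot_product.
Context {R : realType} {d : nat}.
Implicit Types u v w : 'rV[R]_d.

Lemma dotvC u v : dotv u v = dotv v u.
Proof. by apply: eq_bigr => k _; rewrite mulrC. Qed.

Lemma dotvDl u v w : dotv (u + v) w = dotv u w + dotv v w.
Proof. by rewrite -big_split; apply: eq_bigr => k _; rewrite mxE mulrDl. Qed.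

Lemma dotvZl a u v : dotv (a *: u) v = a * dotv u v.
Proof. by rewrite mulr_sumr; apply: eq_bigr => k _; rewrite mxE mulrA. Qed.

Lemma dotv_suml (I : Type) (s : seq I) (Q : pred I) (u : I -> 'rV[R]_d) v :
  dotv (\sum_(i <- s | Q i) u i) v = \sum_(i <- s | Q i) dotv (u i) v.
Proof.
by rewrite exchange_big; apply: eq_bigr => k _; rewrite summxE mulr_suml.
Qed.

Lemma dotv_sumr (I : Type) (s : seq I) (Q : pred I) u (v : I -> 'rV[R]_d) :
  dotv u (\sum_(i <- s | Q i) v i) = \sum_(i <- s | Q i) dotv u (v i).
Proof. by rewrite dotvC dotv_suml; under eq_bigr do rewrite dotvC. Qed.

Lemma dotv_ge0 u : 0 <= dotv u u.
Proof. by apply: sumr_ge0 => k _; exact: sqr_ge0. Qed.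

Lemma sqr_l2norm u : l2norm u ^+ 2 = dotv u u.
Proof. by rewrite sqr_sqrtr // dotv_ge0. Qed.

Lemma dotv_sqrD u v : dotv (u + v) (u + v) = dotv u u + 2 * dotv u v + dotv v v.
Proof.
by rewrite dotvDl ![dotv _ (_ + _)]dotvC !dotvDl (dotvC v u); ring.
Qed.

End dot_product.

(** * Mean square deviation as second moment minus squared mean *)

Lemma avgR_sqr_dev (R : realType) (n : nat) (a : 'I_n -> R) : (0 < n)%N ->
  avgR (fun i => (a i - avgR a) ^+ 2) = avgR (fun i => a i ^+ 2) - avgR a ^+ 2.
Proof.
move=> n0; have nR : n%:R != 0 :> R by rewrite pnatr_eq0 -lt0n.
set m := avgR a.
have -> : avgR (fun i => (a i - m) ^+ 2) =
    n%:R^-1 * (\sum_i a i ^+ 2 - 2 * m * \sum_i a i + n%:R * m ^+ 2).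
  have -> : n%:R * m ^+ 2 = \sum_(i < n) m ^+ 2.
    by rewrite sumr_const card_ord mulr_natl.
  congr (_ * _); rewrite mulr_sumr -sumrB -big_split.
  by apply: eq_bigr => i _ /=; ring.
have -> : \sum_i a i = n%:R * m by rewrite /m /avgR mulrA divff ?mul1r.
by rewrite /avgR; field.
Qed.

(** Both sides are sums over coordinates, so the scalar identity [avgR_sqr_dev] applies to each
    coordinate separately. *)
Lemma avgR_l2norm_dev (R : realType) (n d : nat) (v : 'I_n -> 'rV[R]_d) :
  (0 < n)%N ->
  avgR (fun i => l2norm (v i - average v) ^+ 2) =
  avgR (fun i => l2norm (v i) ^+ 2) - l2norm (average v) ^+ 2.
Proof.
move=> n0; rewrite sqr_l2norm.
have avg_sum (F : 'I_n -> 'I_d -> R) :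
    avgR (fun i => \sum_k F i k) = \sum_k avgR (F^~ k).
  by rewrite /avgR exchange_big mulr_sumr.
under [in LHS]eq_fun do rewrite sqr_l2norm.
under [in RHS]eq_fun do rewrite sqr_l2norm.
rewrite !avg_sum -sumrB; apply: eq_bigr => k _.
have -> : average v 0 k = avgR (fun i => v i 0 k) by rewrite !mxE summxE.
rewrite -expr2 -(avgR_sqr_dev _ _ _ n0).
by congr (_ * _); apply: eq_bigr => i _; rewrite !mxE expr2 summxE.
Qed.

(** * First and second moments of scalar batch averages *)

Section subsampling_moments.
Context {R : realType} {d n b : nat} (pi : {set 'I_n} -> R) (beff : \bar R).
(* For d = 0, pi_unb and pi_eff are void: all vectors vanish. *)
Hypotheses (n0 : (0 < n)%N) (b0 : (0 < b)%N) (d0 : (0 < d)%N).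
Hypothesis pi_sub : subsampling b pi.
Hypothesis pi_unb : unbiased_subsampling d b pi.
Hypothesis pi_eff : effective_size d b pi beff.
Let c := inv_size beff.

(** Scalars are placed on a coordinate axis, which exists by [d0], and the vector identity is read
    off in that coordinate. The type [R^o] views [R] as a module over itself, so that
    [batch_average] also serves for scalars. *)
Lemma unbiased_scalar (a : 'I_n -> R) :
  \sum_(S : {set 'I_n}) pi S * batch_average b (a : 'I_n -> R^o) S = avgR a.
Proof.
have /rowP/(_ (Ordinal d0)) := pi_unb (fun i => a i *: delta_mx 0 (Ordinal d0)).
rewrite !mxE !summxE => E; transitivity (n%:R^-1 *
    \sum_i (a i *: delta_mx 0 (Ordinal d0) : 'rV[R]_d) 0 (Ordinal d0)); last first.
  by congr (_ * _); apply: eq_bigr => i _; rewrite !mxE !eqxx mulr1.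
rewrite -E; apply: eq_bigr => S _; rewrite !mxE summxE; congr (_ * (_ * _)).
by apply: eq_bigr => i _; rewrite !mxE !eqxx mulr1.
Qed.

(** The vectors [a i *: e] lie on one line with [e] of length 1, so squared norms become squares of
    scalars. *)
Lemma effective_size_scalar (a : 'I_n -> R) :
  \sum_(S : {set 'I_n})
     pi S * (batch_average b (a : 'I_n -> R^o) S - avgR a) ^+ 2 =
  c * avgR (fun i => (a i - avgR a) ^+ 2).
Proof.
pose e : 'rV[R]_d := delta_mx 0 (Ordinal d0).
pose v i := a i *: e.
have e1 (t : R) : l2norm (t *: e) ^+ 2 = t ^+ 2.
  rewrite sqr_l2norm dotvZl dotvC dotvZl /dotv (bigD1 (Ordinal d0))//=.
  rewrite big1 ?addr0 => [|k /negbTE nk]; first by rewrite !mxE !eqxx !mulr1.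
  by rewrite !mxE nk andbF mulr0.
have av : average v = avgR a *: e by rewrite /average -scaler_suml scalerA.
have bv S : batch_average b v S = batch_average b (a : 'I_n -> R^o) S *: e.
  by rewrite /batch_average -scaler_suml scalerA.
have := pi_eff.2 v; rewrite /batch_trVar pi_unb av -/c.
under eq_bigr do rewrite bv -scalerBl e1.
by move=> ->; congr (_ * (_ * _)); apply: eq_bigr => i _; rewrite -scalerBl e1.
Qed.

(** Second moment equals variance plus squared mean: the variance comes from the effective sample
    size, the mean from unbiasedness. *)
Lemma batch_second_moment (a : 'I_n -> R) :
  \sum_(S : {set 'I_n}) pi S * batch_average b (a : 'I_n -> R^o) S ^+ 2 =
  c * avgR (fun i => a i ^+ 2) + (1 - c) * avgR a ^+ 2.
Proof.
have [_ pi1 _] := pi_sub.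
have := effective_size_scalar a; rewrite avgR_sqr_dev//.
under eq_bigr do rewrite sqrrB mulrDr mulrBr.
rewrite big_split sumrB /= -mulr_suml pi1 mul1r.
rewrite (_ : \sum_(S : {set 'I_n}) pi S * (_ *+ 2) =
    2 * avgR a * \sum_(S : {set 'I_n}) pi S * batch_average b (a : 'I_n -> R^o) S);
  last by rewrite mulr_sumr; apply: eq_bigr => S _; rewrite -mulr_natl; ring.
by rewrite unbiased_scalar => E; lra.
Qed.

(** The double sum over [S] is [rho] times the square of the sum of the [s i], plus a diagonal
    excess of [1 - rho] times the sum of squares. After averaging, the first part is a second
    moment; the second is a first moment and keeps one factor [1 / b]. *)
Lemma batch_covariance (rho : R) (s : 'I_n -> R) :
  \sum_(S : {set 'I_n}) pi S * (b%:R^-2 * \sum_(i in S) \sum_(j in S)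
    (if i == j then s i ^+ 2 else rho * s i * s j)) =
  (rho * c + (1 - rho) / b%:R) * avgR (fun i => s i ^+ 2)
  + rho * (1 - c) * avgR s ^+ 2.
Proof.
have bR : b%:R != 0 :> R by rewrite pnatr_eq0 -lt0n.
transitivity (rho * (\sum_(S : {set 'I_n})
    pi S * batch_average b (s : 'I_n -> R^o) S ^+ 2) +
  (1 - rho) / b%:R * \sum_(S : {set 'I_n})
    pi S * batch_average b (fun i => s i ^+ 2 : R^o) S).
  rewrite !mulr_sumr -big_split; apply: eq_bigr => S _ /=.
  have -> : \sum_(i in S) \sum_(j in S)
      (if i == j then s i ^+ 2 else rho * s i * s j) =
      rho * (\sum_(i in S) s i) ^+ 2 + (1 - rho) * \sum_(i in S) s i ^+ 2.
    rewrite expr2 mulr_suml !mulr_sumr -big_split; apply: eq_bigr => i iS /=.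
    rewrite mulr_sumr mulr_sumr !(bigD1 (P := mem S) i iS) /= eqxx.
    rewrite (eq_bigr (fun j => rho * (s i * s j))); last first.
      by move=> j /andP[_ /negbTE ji]; rewrite eq_sym ji mulrA.
    by ring.
  by rewrite /batch_average /GRing.scale /=; field.
by rewrite batch_second_moment unbiased_scalar; ring.
Qed.

End subsampling_moments.

(** * Integration over an event independent of the integrand *)

Section independence.
Context {disp : measure_display} {Omega : measurableType disp} {R : realType}.
Context (P : probability Omega R).

(* P restricted to A and p * P have the same image under the identity map from
   Omega to the coarser measurable space generated by G. *)
Lemma ge0_integral_indep (G : set (set Omega)) (A : set Omega) (p : R)
    (f : Omega -> \bar R) :
  G `<=` measurable -> measurable A -> 0 <= p ->
  (forall E, <<s G>> E -> P (A `&` E) = (p%:E * P E)%E) ->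
  measurable_fun [set: g_sigma_algebraType G] f ->
  (forall w, 0 <= f w)%E ->
  (\int[P]_(w in A) f w = p%:E * \int[P]_w f w)%E.
Proof.
move=> GM mA p0 indA mf f0.
have mG (E : set Omega) : <<s G>> E -> measurable E.
  exact: (smallest_sub (sigma_algebra_measurable Omega) GM).
pose phi : Omega -> g_sigma_algebraType G := id.
have mphi : measurable_fun setT phi.
  by move=> _ E mE; rewrite setTI; exact: mG.
have mfO : measurable_fun setT f by exact: (measurableT_comp mf mphi).
pose m1 : {measure set Omega -> \bar R} := mrestr P mA.
pose m2 : {measure set Omega -> \bar R} := mscale (NngNum p0) P.
have -> : (\int[P]_(w in A) f w = \int[m1]_w f w)%E.
  (* The space splits into [A], on whose subsets [m1] and [P] agree, and its complement, which is
     [m1]-null. *)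
  have mCA : measurable (~` A) by exact: measurableC.
  rewrite -(setUv A) ge0_integral_setU//; last 2 first.
  - by rewrite setUv.
  - by apply/disj_setPS; rewrite setICr.
  rewrite [X in (_ + X)%E]null_set_integral ?adde0//.
  - apply: eq_measure_integral => E _ EA; rewrite /m1/= /mrestr; congr (P _).
    exact/esym/setIidl.
  - exact: measurable_funTS.
  - by rewrite /= /mrestr setICl measure0.
have e (m : {measure set Omega -> \bar R}) :
    (\int[m]_w f w = \int[pushforward m phi]_w f w)%E.
  by rewrite (ge0_integral_pushforward mphi m measurableT mf).
transitivity (\int[m2]_w f w)%E; last by rewrite ge0_integral_mscale.
rewrite !e; apply: eq_measure_integral => E mE _.
(* On the sets generated by [G], equality of the two image measures is exactly [indA]. *)
by rewrite -[LHS]/(P (E `&` A)) -[RHS]/(p%:E * P E)%E setIC; exact: indA.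
Qed.

(** The nonnegative case is applied to the positive and negative parts of [X]. *)
Lemma expectation_indep (G : set (set Omega)) (A : set Omega) (p : R)
    (X : Omega -> R) :
  G `<=` measurable -> measurable A -> 0 <= p ->
  (forall E, <<s G>> E -> P (A `&` E) = (p%:E * P E)%E) ->
  measurable_fun [set: g_sigma_algebraType G] X ->
  P.-integrable setT (EFin \o X) ->
  (\int[P]_(w in A) (X w)%:E = p%:E * \int[P]_w (X w)%:E)%E.
Proof.
move=> GM mA p0 indA mX iX.
have mE : measurable_fun [set: g_sigma_algebraType G]
    (EFin \o X) by exact/measurable_EFinP.
rewrite [LHS]integralE [X in (_ * X)%E]integralE.
rewrite !(ge0_integral_indep G A p)//.
(* Distributing [p] over the difference requires it to be well defined: the negative part has a
   finite integral. *)
- rewrite [RHS]muleBr//; apply: fin_num_adde_defl; rewrite fin_numN.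
  exact: integrable_neg_fin_num iX.
- exact: measurable_funeneg.
- exact: measurable_funepos.
Qed.

End independence.

(** * A calculus of finite expectations *)

Section expected_value.
Context {disp : measure_display} {Omega : measurableType disp} {R : realType}.
Context (P : probability Omega R).
Implicit Types X Y : Omega -> R.

(** Integrability travels with the value, since linearity of the integral needs it at every step. *)
Definition expects X (r : R) : Prop :=
  P.-integrable setT (EFin \o X) /\ ('E_P[X] = r%:E)%E.

Lemma integrable_expects X :
  P.-integrable setT (EFin \o X) -> expects X (fine 'E_P[X]%E).
Proof.
move=> iX; split => //; rewrite fineK// expectation.unlock.
exact: integrable_fin_num.
Qed.

Lemma expects_cst r : expects (cst r) r.
Proof. by split; [exact: finite_measure_integrable_cst | exact: expectation_cst]. Qed.

Lemma expectsZ a X r : expects X r -> expects (fun w => a * X w) (a * r).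
Proof.
move=> [iX]; rewrite /expects expectation.unlock => eX; split.
  exact: (integrableZl measurableT a iX).
by under eq_integral do rewrite EFinM; rewrite integralZl// eX.
Qed.

Lemma expects_sum (I : Type) (s : seq I) (Q : pred I) (X : I -> Omega -> R)
    (r : I -> R) : (forall i, expects (X i) (r i)) ->
  expects (fun w => \sum_(i <- s | Q i) X i w) (\sum_(i <- s | Q i) r i).
Proof.
rewrite /expects expectation.unlock => eX; split.
  rewrite (_ : _ \o _ = fun w => (\sum_(i <- s | Q i) (X i w)%:E)%E).
    by apply: integrable_sum => // i _; exact: (eX i).1.
  by apply/funext => w /=; rewrite sumEFin.
under eq_integral do rewrite -sumEFin.
rewrite (integral_sum measurableT (fun i => (eX i).1)) -sumEFin.
by apply: eq_bigr => i _; exact: (eX i).2.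
Qed.

Lemma expectsD X Y r s :
  expects X r -> expects Y s -> expects (fun w => X w + Y w) (r + s).
Proof.
move=> [iX]; rewrite /expects expectation.unlock => eX [iY eY]; split.
  exact: (integrableD measurableT iX iY).
by under eq_integral do rewrite EFinD; rewrite integralD// eX eY.
Qed.

Lemma expects_indep (G : set (set Omega)) (A : set Omega) (p : R) X r :
  G `<=` measurable -> measurable A -> 0 <= p ->
  (forall E, <<s G>> E -> P (A `&` E) = (p%:E * P E)%E) ->
  measurable_fun [set: g_sigma_algebraType G] X ->
  expects X r -> expects (fun w => \1_A w * X w) (p * r).
Proof.
move=> GM mA p0 indA mX [iX]; rewrite /expects expectation.unlock => eX.
have E1 : EFin \o (fun w => \1_A w * X w) = (EFin \o X) \_ A.
  apply/funext => w; rewrite /= indicE /patch.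
  by case: ifPn => _; rewrite ?mul1r ?mul0r.
split.
  rewrite E1; apply/(integrable_mkcond _ mA).
  exact: integrableS iX.
transitivity (\int[P]_w ((EFin \o (fun w => (\1_A w * X w)%R)) w))%E => [//|].
by rewrite E1 -integral_mkcond (expectation_indep P G A p) ?eX.
Qed.

End expected_value.

(** * Integrability of centered vectors and of their products *)

Section random_vectors.
Context {disp : measure_display} {Omega : measurableType disp} {R : realType}.
Context (P : probability Omega R) {d : nat}.
Implicit Types Y Z : Omega -> 'rV[R]_d.

Lemma mean_expects Y (v : 'rV[R]_d) :
  (forall k, expects P (fun w => Y w 0 k) (v 0 k)) -> mean P Y = v.
Proof. by move=> eY; apply/rowP => k; rewrite mxE (eY k).2. Qed.

Lemma centered_expects Y k : integrable_vec P Y ->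
  expects P (fun w => (Y w - mean P Y) 0 k) 0.
Proof.
move=> /(_ k)/integrable_expects eY.
have := expectsD P _ _ _ _ eY (expects_cst P (- mean P Y 0 k)).
rewrite mxE subrr; congr expects; apply/funext => w.
by rewrite /= !mxE.
Qed.

(** A squared coordinate is dominated by the squared norm, whose integral is the finite
    [trVar P Y]. *)
Lemma centered_sqr_integrable Y k : finite_variance P Y ->
  P.-integrable setT (EFin \o (fun w => (Y w - mean P Y) 0 k ^+ 2)).
Proof.
move=> [iY vY].
have mZ j : measurable_fun setT (fun w => (Y w - mean P Y) 0 j).
  have [/measurable_int ? _] := centered_expects Y j iY.
  exact/measurable_EFinP.
have mS : measurable_fun setT (fun w => l2norm (Y w - mean P Y) ^+ 2).
  under eq_fun do rewrite sqr_l2norm /dotv.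
  by apply: measurable_sum => j; exact: measurable_funM.
apply: (@le_integrable _ _ _ _ _ measurableT _
    (EFin \o (fun w => l2norm (Y w - mean P Y) ^+ 2))).
- by apply/measurable_EFinP; exact: measurable_funX.
- move=> w _ /=; rewrite lee_fin !ger0_norm ?sqr_ge0//.
  rewrite sqr_l2norm /dotv (bigD1 k)//= -expr2 lerDl.
  by apply: sumr_ge0 => j _; exact: sqr_ge0.
- apply/integrableP; split; first exact/measurable_EFinP.
  move: vY; rewrite /trVar expectation.unlock; apply: le_lt_trans.
  rewrite le_eqVlt; apply/orP; left; apply/eqP.
  by apply: eq_integral => w _ /=; rewrite ger0_norm ?sqr_ge0.
Qed.

Lemma centered_mul_integrable Y Z k : finite_variance P Y ->
  finite_variance P Z ->
  P.-integrable setT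
    (EFin \o (fun w => (Y w - mean P Y) 0 k * (Z w - mean P Z) 0 k)).
Proof.
move=> vY vZ.
have mc X : finite_variance P X ->
    measurable_fun setT (fun w => (X w - mean P X) 0 k).
  move=> [iX _]; have [/measurable_int ? _] := centered_expects X k iX.
  exact/measurable_EFinP.
pose q X w := (X w - mean P X) 0 k ^+ 2.
apply: (@le_integrable _ _ _ _ _ measurableT _
    ((EFin \o q Y) \+ (EFin \o q Z))%E).
- by apply/measurable_EFinP; apply: measurable_funM; exact: mc.
- move=> w _ /=; rewrite lee_fin normrM /q [leRHS]ger0_norm ?addr_ge0 ?sqr_ge0//.
  set a := _ 0 k; set c := _ 0 k.
  rewrite -(real_normK (num_real a)) -(real_normK (num_real c)).
  (* By [h1], twice the product of the absolute values is at most the sum of the squares; by [h2],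
     so is the product itself. *)
  have h1 := sqr_ge0 (`|a| - `|c|); have h2 := mulr_ge0 (normr_ge0 a) (normr_ge0 c).
  by lra.
- by apply: integrableD => //; exact: centered_sqr_integrable.
Qed.

Lemma trCov_expects Y Z : finite_variance P Y -> finite_variance P Z ->
  expects P (fun w => dotv (Y w - mean P Y) (Z w - mean P Z))
    (fine (trCov P Y Z)).
Proof.
move=> vY vZ; apply: integrable_expects.
have := expects_sum P 'I_d (index_enum _) xpredT _ _
  (fun k => integrable_expects P _ (centered_mul_integrable _ _ k vY vZ)).
by case.
Qed.

Lemma trCov_diag Y : trCov P Y Y = trVar P Y.
Proof. by congr expectation; apply/funext => w; rewrite sqr_l2norm. Qed.

Lemma fin_num_trCov Y Z : finite_variance P Y -> finite_variance P Z ->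
  trCov P Y Z = (fine (trCov P Y Z))%:E.
Proof. by move=> vY vZ; exact: (trCov_expects Y Z vY vZ).2. Qed.

End random_vectors.

(** * Mean and variance of a batch average, for a fixed and then a random batch *)

Section batch.
Context {disp : measure_display} {Omega : measurableType disp} {R : realType}.
Context (P : probability Omega R) {d n : nat} (b : nat).
Context (Y : 'I_n -> Omega -> 'rV[R]_d).
Hypothesis vY : forall i, finite_variance P (Y i).
Let m i := mean P (Y i).

(** Around the batch mean the deviation is a centered sum plus the constant [c], so the cross term
    has expectation zero. The center [v] is arbitrary because it will be the mean over all batches,
    not the mean for [S]. *)
Lemma fixed_batch_expects (S : {set 'I_n}) (v : 'rV[R]_d) :
  expects P
    (fun w => l2norm (batch_average b (Y ^~ w) S - v) ^+ 2)
    (b%:R^-2 * (\sum_(i in S) \sum_(j in S) fine (trCov P (Y i) (Y j))) +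
     l2norm (batch_average b m S - v) ^+ 2).
Proof.
pose Z i w := Y i w - m i.
set c := batch_average b m S - v.
have eZZ : expects P (fun w => b%:R^-2 * \sum_(i in S) \sum_(j in S)
    dotv (Z i w) (Z j w))
    (b%:R^-2 * \sum_(i in S) \sum_(j in S) fine (trCov P (Y i) (Y j))).
  apply: expectsZ; apply: expects_sum => i; apply: expects_sum => j.
  exact: trCov_expects.
have eZc : expects P (fun w => 2 * (b%:R^-1 * \sum_(i in S) dotv (Z i w) c)) 0.
  (* Zero is written in the shape that [expectsZ] and [expects_sum] produce from the centered
     coordinates. *)
  have e0 : 2 * (b%:R^-1 * \sum_(i in S) \sum_k (c 0 k * 0)) = 0 :> R.
    by rewrite big1 ?mulr0// => i _; rewrite big1// => k _; rewrite mulr0.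
  rewrite -[X in expects P _ X]e0.
  do 2 apply: expectsZ; apply: expects_sum => i.
  rewrite [X in expects P X](_ : _ = fun w => \sum_k c 0 k * Z i w 0 k).
    apply: expects_sum => k; apply: expectsZ.
    by apply: centered_expects; exact: (vY i).1.
  by apply/funext => w; rewrite dotvC.
have := expectsD P _ _ _ _ (expectsD P _ _ _ _ eZZ eZc)
  (expects_cst P (l2norm c ^+ 2)).
rewrite addr0; congr expects; apply/funext => w /=.
have -> : batch_average b (Y^~ w) S - v = b%:R^-1 *: (\sum_(i in S) Z i w) + c.
  rewrite /c /batch_average /Z sumrB scalerBr addrA; congr (_ + _).
  by rewrite subrK.
rewrite !sqr_l2norm [RHS]dotv_sqrD (dotvZl _ _ c).
congr (_ + _ * (_ * _) + _); last by rewrite dotv_suml.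
rewrite dotvZl dotvC dotvZl mulrA -expr2 exprVn; congr (_ * _).
by rewrite dotv_suml; apply: eq_bigr => i _; rewrite dotv_sumr.
Qed.

Context (B : Omega -> {set 'I_n}) (pi : {set 'I_n} -> R).
Hypothesis pi0 : forall S, 0 <= pi S.
Hypothesis lawB : has_law P B pi.
Hypothesis indB : indep_set_family P B Y.

(** Spelled as the generating family in [indep_set_family], so that [indB] applies to the events of
    [<<s G>>]. *)
Let G := [set C | exists (i : 'I_n) (k : 'I_d) (A : set R),
           measurable A /\ C = (fun w => Y i w 0 k) @^-1` A].

(** Law of total expectation: the finitely many events on which [B] equals [S] partition the space,
    and independence factors each piece as [pi S * r S]. *)
Lemma random_batch_expects (h : {set 'I_n} -> Omega -> R) (r : {set 'I_n} -> R) :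
  (forall S, measurable_fun [set: g_sigma_algebraType G] (h S)) ->
  (forall S, expects P (h S) (r S)) ->
  expects P (fun w => h (B w) w) (\sum_S pi S * r S).
Proof.
move=> mh eh.
have GM : G `<=` measurable.
  move=> C [i [k [A [mA ->]]]].
  have /measurable_int/measurable_EFinP mYik := (vY i).1 k.
  by rewrite -[X in measurable X]setTI; exact: mYik.
rewrite [X in expects P X](_ : _ =
    fun w => \sum_S \1_(B @^-1` [set S]) w * h S w).
  apply: expects_sum => S; have [mS PS] := lawB S.
  apply: (expects_indep P G) => // E GE.
  by rewrite -PS; exact: indB.
(* At [w] only the indicator belonging to [S = B w] is nonzero. *)
apply/funext => w; rewrite (bigD1 (B w))//= indicE mem_set// mul1r.
by rewrite big1 ?addr0// => S /eqP SB; rewrite indicE memNset ?mul0r//= => /esym.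
Qed.

Lemma measurable_generated i k :
  measurable_fun [set: g_sigma_algebraType G] (fun w => Y i w 0 k).
Proof.
move=> _ A mA; rewrite setTI; apply: sub_sigma_algebra.
by exists i, k, A.
Qed.

Lemma measurable_batch_average S k :
  measurable_fun [set: g_sigma_algebraType G]
    (fun w => batch_average b (Y ^~ w) S 0 k).
Proof.
rewrite (_ : (fun w => _) =
    fun w => b%:R^-1 * \sum_(i <- enum S) Y i w 0 k).
  apply: measurable_funM; first exact: measurable_cst.
  by apply: measurable_sum => i; exact: measurable_generated.
by apply/funext => w; rewrite !mxE summxE big_enum.
Qed.

Lemma mean_random_batch :
  mean P (fun w => batch_average b (Y ^~ w) (B w)) = batch_mean b pi m.
Proof.
apply: mean_expects => k.
rewrite [X in expects P _ X](_ : _ =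
    \sum_S pi S * batch_average b m S 0 k); last first.
  by rewrite summxE; apply: eq_bigr => S _; rewrite mxE.
apply: (random_batch_expects (fun S w => batch_average b (Y ^~ w) S 0 k)) => S.
  exact: measurable_batch_average.
rewrite [X in expects P X](_ : _ =
    fun w => b%:R^-1 * \sum_(i in S) Y i w 0 k).
  rewrite !mxE summxE; apply: expectsZ; apply: expects_sum => i.
  by rewrite mxE; apply: integrable_expects; exact: (vY i).1.
by apply/funext => w; rewrite !mxE summxE.
Qed.

(** Law of total variance: the first sum is the expected variance given the batch, the second term
    the variance of the conditional mean. *)
Lemma trVar_random_batch :
  trVar P (fun w => batch_average b (Y ^~ w) (B w)) =
  (\sum_S pi S *
     (b%:R^-2 * (\sum_(i in S) \sum_(j in S) fine (trCov P (Y i) (Y j))))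
   + batch_trVar b pi m)%:E.
Proof.
rewrite /trVar mean_random_batch.
rewrite /batch_trVar -big_split /=; under [in RHS]eq_bigr do rewrite -mulrDr.
apply: (random_batch_expects (fun S w =>
  l2norm (batch_average b (Y ^~ w) S - batch_mean b pi m) ^+ 2) _ _ _).2 => S.
  under eq_fun do rewrite sqr_l2norm /dotv.
  apply: measurable_sum => k; apply: measurable_funM;
    under eq_fun do rewrite mxE; apply: measurable_funD => //;
    exact: measurable_batch_average.
exact: fixed_batch_expects.
Qed.

End batch.

(** * First-order optimality at an interior minimizer *)

Lemma derivative_argmin_ge0 (R : realType) (V : normedModType R) (D : set V)
    (F : V -> R) (x v : V) :
  interior D x -> argmin D F x -> derivable F x v -> 0 <= 'D_v F x.
Proof.
move=> Dx [_ Fmin] dF.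
(* With [h] restricted to positive values the quotient is nonnegative as soon as [h *: v + x] lies
   in [D]. *)
have dF0 : (h^-1 *: (F (h *: v + x) - F x) @[h --> 0^'+]) --> 'D_v F x.
  by apply: cvg_dnbhs_at_right; exact: dF.
rewrite -(cvg_lim (@Rhausdorff R) dF0); apply: limr_ge.
  by apply/cvg_ex; eexists; exact: dF0.
have near_D : \forall h \near 0^'+, D (h *: v + x).
  have c : h *: v + x @[h --> (0 : R)^'+] --> 0 *: v + x.
    apply: cvgD; last exact: cvg_cst.
    by apply: cvgZr_tmp; apply: cvg_at_right_filter; exact: cvg_id.
  rewrite scale0r add0r in c.
  exact: (c D Dx).
near=> h.
have h0 : 0 < h by near: h; exact: nbhs_right_gt.
have Dh : D (h *: v + x) by near: h.
have := Fmin _ Dh; rewrite -subr_ge0 => Fh.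
by apply: mulr_ge0 => //; rewrite invr_ge0 ltW.
Unshelve. all: by end_near.
Qed.

(** The one-sided inequality holds along [v] and along [- v], and the differential is linear. *)
Lemma derivative_argmin (R : realType) (V : normedModType R) (D : set V)
    (F : V -> R) (x v : V) :
  interior D x -> argmin D F x -> differentiable F x -> 'D_v F x = 0.
Proof.
move=> Dx Fx dF; apply/eqP; rewrite eq_le.
have ge0 u : 0 <= 'D_u F x.
  by apply: derivative_argmin_ge0 Fx _; [|exact: diff_derivable].
by rewrite ge0 andbT -oppr_ge0 deriveE// -linearN -deriveE.
Qed.

Lemma gradient_avg (R : realType) (n d : nat) (f : 'I_n -> 'rV[R]_d -> R) x :
  (forall i, differentiable (f i) x) ->
  gradient (fun y => avgR (fun i => f i y)) x = average (fun i => gradient (f i) x).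
Proof.
move=> df; apply/rowP => k; rewrite !mxE summxE.
rewrite (_ : (fun y => _) = n%:R^-1 \*: (\sum_(i < n) f i)).
  rewrite deriveZ ?derive_sum//=; last 2 first.
  - by move=> i; exact: diff_derivable.
  - by apply: derivable_sum => i; exact: diff_derivable.
  by congr (_ * _); apply: eq_bigr => i _; rewrite mxE.
by apply/funext => y; rewrite /avgR /= fct_sumE.
Qed.

Lemma gradient_argmin (R : realType) (n d : nat) (D : set 'rV[R]_d)
    (f : 'I_n -> 'rV[R]_d -> R) x :
  (forall i, differentiable (f i) x) -> interior D x ->
  argmin D (fun y => avgR (fun i => f i y)) x ->
  gradient (fun y => avgR (fun i => f i y)) x = 0.
Proof.
move=> df Dx xmin; apply/rowP => k; rewrite !mxE.
apply: derivative_argmin Dx xmin _.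
rewrite (_ : (fun y => _) = n%:R^-1 \*: (\sum_(i < n) f i)).
  by apply: differentiableZ; apply: differentiable_sum.
by apply/funext => y; rewrite /avgR /= fct_sumE.
Qed.

(** * Sign of the variance constant, and dimension zero *)

Lemma inv_size_ge0 (R : realType) (beff : \bar R) : (0 < beff)%E -> 0 <= inv_size beff.
Proof. by move=> h; rewrite fine_ge0// inve_ge0 ltW. Qed.

(** The sign of [1 - c] is unknown, so the terms are regrouped around [A - S ^+ 2], which is
    nonnegative as a mean square deviation. *)
Lemma BV_constant_ge0 (R : realType) (n b : nat) (beff : \bar R) (rho tau : R)
    (sigma : 'I_n -> R) : (0 < n)%N -> (0 < beff)%E -> 0 <= rho <= 1 ->
  0 <= BV_constant b beff rho tau sigma.
Proof.
move=> n0 /inv_size_ge0 c0 /andP[r0 r1]; rewrite /BV_constant.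
have n1 : 0 <= n%:R^-1 :> R by rewrite invr_ge0.
have dev0 : 0 <= avgR (fun i => (sigma i - avgR sigma) ^+ 2).
  by apply: mulr_ge0 => //; apply: sumr_ge0 => i _; exact: sqr_ge0.
have A0 : 0 <= avgR (fun i => sigma i ^+ 2).
  by apply: mulr_ge0 => //; apply: sumr_ge0 => i _; exact: sqr_ge0.
rewrite avgR_sqr_dev// subr_ge0 in dev0.
set c := inv_size beff in c0 *; set A := avgR (fun i => sigma i ^+ 2) in dev0 A0 *.
set S := avgR sigma in dev0 *.
have -> : (rho * c + (1 - rho) / b%:R) * A + rho * (1 - c) * S ^+ 2 + tau ^+ 2 * c =
  rho * c * (A - S ^+ 2) + (1 - rho) / b%:R * A + rho * S ^+ 2 + tau ^+ 2 * c by ring.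
have h1 : 0 <= 1 - rho by rewrite subr_ge0.
have h2 : 0 <= A - S ^+ 2 by rewrite subr_ge0.
apply: addr_ge0; last exact: mulr_ge0 (sqr_ge0 _) c0.
apply: addr_ge0; last exact: mulr_ge0 r0 (sqr_ge0 S).
by apply: addr_ge0; apply: mulr_ge0 => //; apply: mulr_ge0; rewrite ?invr_ge0.
Qed.

Lemma trVar_dim0 (disp : measure_display) (Omega : measurableType disp)
    (R : realType) (P : probability Omega R) (Y : Omega -> 'rV[R]_0) :
  trVar P Y = 0%E.
Proof.
rewrite /trVar (_ : (fun w => _) = cst 0) ?expectation_cst//.
by apply/funext => w; rewrite sqr_l2norm /dotv big_ord0.
Qed.

(** * The bound and its equality case at a single point *)

Section variance_bound.
Context {disp : measure_display} {Omega : measurableType disp} {R : realType}.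
Context (P : probability Omega R) {d n b : nat}.
Hypotheses (n0 : (0 < n)%N) (b0 : (0 < b)%N).
Context (Y : 'I_n -> Omega -> 'rV[R]_d).
Hypothesis vY : forall i, finite_variance P (Y i).
Context (pi : {set 'I_n} -> R) (beff : \bar R).
Hypothesis pi_sub : subsampling b pi.
Hypothesis pi_unb : unbiased_subsampling d b pi.
Hypothesis pi_eff : effective_size d b pi beff.
Context (B : Omega -> {set 'I_n}).
Hypothesis lawB : has_law P B pi.
Hypothesis indB : indep_set_family P B Y.
Context (rho tau : R) (sigma : 'I_n -> R).
Let m i := mean P (Y i).
Let c := inv_size beff.

Lemma trVar_random_batch_effective :
  trVar P (fun w => batch_average b (Y ^~ w) (B w)) =
  (\sum_S pi S *
     (b%:R^-2 * (\sum_(i in S) \sum_(j in S) fine (trCov P (Y i) (Y j))))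
   + c * (avgR (fun i => l2norm (m i) ^+ 2) - l2norm (average m) ^+ 2))%:E.
Proof.
have [pi0 _ _] := pi_sub.
by rewrite (trVar_random_batch P b Y vY B pi)// pi_eff.2 avgR_l2norm_dev.
Qed.

Lemma trVar_random_batch_le : 0 <= rho <= 1 -> (forall i, 0 <= sigma i) ->
  (forall i j, i != j ->
     (trCov P (Y i) (Y j) <=
       (rho * Num.sqrt (fine (trVar P (Y i)))
            * Num.sqrt (fine (trVar P (Y j))))%:E)%E) ->
  (forall i, (trVar P (Y i) <= (sigma i ^+ 2)%:E)%E) ->
  avgR (fun i => l2norm (m i) ^+ 2) <= tau ^+ 2 ->
  (trVar P (fun w => batch_average b (Y ^~ w) (B w))
    <= (BV_constant b beff rho tau sigma)%:E)%E.
Proof.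
move=> rho01 s0 hcov hvar htau.
have [d0|d0] := posnP d.
  move: (Y); rewrite d0 => Y0.
  by rewrite trVar_dim0 lee_fin; apply: BV_constant_ge0 => //; exact: pi_eff.1.
have [pi0 _ _] := pi_sub; have c0 : 0 <= c by exact: inv_size_ge0 pi_eff.1.
rewrite trVar_random_batch_effective lee_fin /BV_constant.
rewrite -(batch_covariance pi beff n0 b0 d0 pi_sub pi_unb pi_eff).
(* In the term of the conditional means, the nonpositive contribution of [average m] is discarded
   and [htau] bounds the rest. *)
apply: lerD; last first.
  rewrite [leRHS]mulrC; apply: ler_wpM2l => //.
  by rewrite (le_trans _ htau)// gerBl sqr_ge0.
(* The covariance bound holds for each index set and each pair of indices, hence after averaging
   with nonnegative weights. *)
apply: ler_sum => S _; apply: ler_wpM2l => //; apply: ler_wpM2l.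
  by rewrite invr_ge0 exprn_ge0.
have varE i : trVar P (Y i) = (fine (trVar P (Y i)))%:E.
  by rewrite -trCov_diag -fin_num_trCov.
have sd i : Num.sqrt (fine (trVar P (Y i))) <= sigma i.
  rewrite -[leRHS](ger0_norm (s0 i)) -sqrtr_sqr.
  by apply: ler_wsqrtr; rewrite -lee_fin -varE.
apply: ler_sum => i _; apply: ler_sum => j _; case: eqVneq => [<-|ij].
  by rewrite trCov_diag -lee_fin -varE.
rewrite -lee_fin -fin_num_trCov//; apply: (le_trans (hcov i j ij)).
have /andP[r0 _] := rho01.
by rewrite lee_fin -!mulrA ler_wpM2l// ler_pM ?sqrtr_ge0.
Qed.

Lemma trVar_random_batch_eq : (forall i, 0 <= sigma i) ->
  (forall i j, i != j ->
     trCov P (Y i) (Y j) =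
       (rho * Num.sqrt (fine (trVar P (Y i)))
            * Num.sqrt (fine (trVar P (Y j))))%:E) ->
  (forall i, trVar P (Y i) = (sigma i ^+ 2)%:E) ->
  avgR (fun i => l2norm (m i) ^+ 2) = tau ^+ 2 ->
  ((beff < +oo)%E -> average m = 0) ->
  trVar P (fun w => batch_average b (Y ^~ w) (B w))
    = (BV_constant b beff rho tau sigma)%:E.
Proof.
move=> s0 hcov hvar htau hmean.
have [d0|d0] := posnP d.
  (* In dimension zero the equalities force each [sigma i] and [tau ^+ 2] to vanish, so both sides
     are zero. *)
  have s00 i : sigma i = 0.
    move: (hvar i); move: (Y i); rewrite d0 => Yi; rewrite trVar_dim0 => -[/esym/eqP].
    by rewrite sqrf_eq0 => /eqP.
  have t0 : tau ^+ 2 = 0.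
    rewrite -htau /avgR big1 ?mulr0// => i _; rewrite sqr_l2norm /dotv.
    by apply: big1 => k _; have := ltn_ord k; rewrite [X in (_ < X)%N]d0.
  have -> : BV_constant b beff rho tau sigma = 0.
    rewrite /BV_constant t0 /avgR !big1 ?mulr0 ?expr0n /= ?mulr0 ?mul0r ?addr0//.
    by move=> i _; rewrite s00 expr0n.
  move: (Y); rewrite d0 => Y0; exact: trVar_dim0.
rewrite trVar_random_batch_effective /BV_constant; congr EFin.
rewrite -(batch_covariance pi beff n0 b0 d0 pi_sub pi_unb pi_eff).
congr (_ + _); last first.
  (* For finite [beff], [hmean] removes the squared norm of the average; otherwise [c] is the
     inverse of infinity, that is zero. *)
  rewrite htau mulrC; have [beffoo|] := boolP (beff < +oo)%E.
    by rewrite hmean// sqr_l2norm [dotv _ _]big1 ?subr0// => k _; rewrite mxE mul0r.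
  by rewrite -leNgt leye_eq /c /inv_size => /eqP ->; rewrite invey !mulr0.
apply: eq_bigr => S _; congr (_ * (_ * _)).
apply: eq_bigr => i _; apply: eq_bigr => j _; case: eqVneq => [<-|ij].
  by rewrite trCov_diag hvar.
by rewrite hcov// !hvar /= !sqrtr_sqr !ger0_norm.
Qed.

End variance_bound.

(** The equality clause takes equality in all the assumed bounds at [x]. For finite [beff] the
    discarded multiple of the squared norm of [gradient F x] must vanish too; at a boundary
    minimizer this can fail, whence the alternative of an interior point or a zero gradient. *)
Theorem theorem3 (R : realType) (disp : measure_display)
    (Omega : measurableType disp) (P : probability Omega R)
    (d n b : nat) (hn : (0 < n)%N) (hb : (0 < b)%N)
    (D : set 'rV[R]_d) (f : 'I_n -> 'rV[R]_d -> R)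
    (hf : forall i x, D x -> differentiable (f i) x)
    (g : 'I_n -> 'rV[R]_d -> Omega -> 'rV[R]_d)
    (hg : forall i x, D x ->
       integrable_vec P (g i x) /\ mean P (g i x) = gradient (f i) x)
    (pi : {set 'I_n} -> R) (beff : \bar R)
    (hpi : subsampling b pi)
    (hunb : unbiased_subsampling d b pi)
    (heff : effective_size d b pi beff)
    (B : Omega -> {set 'I_n})
    (hB : has_law P B pi)
    (hind : forall x, D x -> indep_set_family P B (fun i => g i x))
    (rho : R) (hrho : 0 <= rho <= 1)
    (hfin : forall i x, D x -> finite_variance P (g i x))
    (hcov : forall x, D x -> forall i j, i != j ->
       (trCov P (g i x) (g j x) <=
         (rho * Num.sqrt (fine (trVar P (g i x)))
              * Num.sqrt (fine (trVar P (g j x))))%:E)%E)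
    (tau : R) (sigma : 'I_n -> R)
    (htau0 : 0 <= tau) (hsigma0 : forall i, 0 <= sigma i)
    (htau : forall x, argmin D (fun y => avgR (fun i => f i y)) x ->
       avgR (fun i => l2norm (gradient (f i) x) ^+ 2) <= tau ^+ 2)
    (hsigma : forall x, argmin D (fun y => avgR (fun i => f i y)) x ->
       forall i, (trVar P (g i x) <= (sigma i ^+ 2)%:E)%E) :
  let F := fun y => avgR (fun i => f i y) in
  let gB := fun x w => batch_average b (fun i => g i x w) (B w) in
  let sigma2 := BV_constant b beff rho tau sigma in
  BV P D F gB sigma2 /\
  (forall x, argmin D F x ->
     (forall i j, i != j ->
        trCov P (g i x) (g j x) =
          (rho * Num.sqrt (fine (trVar P (g i x)))
               * Num.sqrt (fine (trVar P (g j x))))%:E) ->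
     (forall i, trVar P (g i x) = (sigma i ^+ 2)%:E) ->
     avgR (fun i => l2norm (gradient (f i) x) ^+ 2) = tau ^+ 2 ->
     ((beff < +oo)%E -> interior D x \/ gradient F x = 0) ->
     trVar P (gB x) = sigma2%:E).
Proof.
move=> F gB sigma2.
have avg_grad x : D x ->
    average (fun i => mean P (g i x)) = gradient F x.
  move=> Dx; rewrite gradient_avg; last by move=> i; exact: hf.
  by congr average; apply/funext => i; exact: (hg i x Dx).2.
have meanE x : D x -> (fun i => l2norm (mean P (g i x)) ^+ 2) =
    (fun i => l2norm (gradient (f i) x) ^+ 2).
  by move=> Dx; apply/funext => i; rewrite (hg i x Dx).2.
split=> [x xmin|x xmin ecov evar etau ewhy]; have Dx := xmin.1.
  apply: (trVar_random_batch_le P hn hb (fun i => g i x) _ pi) => //.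
  - by move=> i; exact: hfin.
  - exact: hind.
  - exact: hcov.
  - exact: hsigma.
  - by rewrite meanE//; exact: htau.
apply: (trVar_random_batch_eq P hn hb (fun i => g i x) _ pi) => //.
- by move=> i; exact: hfin.
- exact: hind.
- by rewrite meanE.
(* The average of the means is the gradient of [F]; it vanishes by Fermat's rule in the interior
   case and by assumption in the other. *)
move=> /ewhy[Dx0|gF0]; rewrite avg_grad//.
by apply: gradient_argmin Dx0 xmin => i; exact: hf.
Qed.
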